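(* Let $s>0$, $\lambda>0$ and $K\ge 1$. Let $\rho$ be a distortion measure on a measurable space $E$ such that $w:=\sup_{x,y\in E}\rho(x,y)<\infty$ and such that the upper box dimension $$\gamma:=\limsup_{\varepsilon\to 0}\frac{\log N(E,\rho,\varepsilon)}{\log(1/\varepsilon)}$$ is finite. Let $X$ be a $\mathbf D([0,1),E)$-valued random element whose number of jumps $N_X$ satisfies $\mathbb P(N_X=k)\le \frac{\lambda^k}{k!}e^{-\lambda}K$ for all integers $k\ge 0$. Then, as $r\to\infty$, $$-\log D^{(q)}(r\,|\,X,\rho_{\mathbf D},s)\ \gtrsim\ \sqrt{\frac{2}{s(1+\gamma)}\,r\log r},$$ i.e. $\liminf_{r\to\infty}\big(-\log D^{(q)}(r\,|\,X,\rho_{\mathbf D},s)\big)\big/\sqrt{\tfrac{2}{s(1+\gamma)}r\log r}\ge 1$.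
   Context: A distortion measure on a measurable space $E$ is a measurable symmetric function $\rho:E\times E\to[0,\infty)$ with $\rho(x,y)=0$ iff $x=y$. The covering number $N(E,\rho,\varepsilon)$ is the smallest $n\in\mathbb N$ such that there exist $x_1,\dots,x_n\in E$ with: for every $x\in E$ there is $i$ with $\rho(x,x_i)\le\varepsilon$. $\mathbf D([0,1),E)$ is the space of functions $f:[0,1)\to E$ that are piecewise constant with finitely many jumps, where a jump at $t$ from value $a$ to value $b$ means $f(t)=b$; it carries the $\sigma$-field generated by the projections $f\mapsto f(t)$. On it one uses the distortion $\rho_{\mathbf D}(f,g)=\int_0^1\rho(f(t),g(t))\,dt$. $N_X$ denotes the (random) number of jumps of $X$. For a random variable $X$ in a space with distortion $\rho$, the quantization error is $$D^{(q)}(r\,|\,X,\rho,s)=\inf\Big\{\big(\mathbb E\min_{a\in\mathcal C}\rho(X,a)^s\big)^{1/s}:\ \mathcal C\text{ a set of points with }\log\#\mathcal C\le r\Big\},$$ with natural logarithms throughout. *)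

(* Defs.v *)
From HB Require Import structures.
From mathcomp Require Import all_boot all_order all_algebra.
From mathcomp Require Import finmap.
From mathcomp Require Import all_classical all_reals all_analysis.
Set Implicit Arguments. Unset Strict Implicit. Unset Printing Implicit Defensive.
Import Order.TTheory GRing.Theory Num.Theory.
Local Open Scope classical_set_scope.
Local Open Scope ring_scope.

Section Defs.
Context {R : realType}.

Definition distortion {dE : measure_display} {E : measurableType dE}
  (rho : E -> E -> R) : Prop :=
  [/\ measurable_fun setT (fun p : E * E => rho p.1 p.2),
      (forall x y, rho x y = rho y x),
      (forall x y, 0 <= rho x y) &
      (forall x y, rho x y = 0 <-> x = y)].

(* covering number N(E, rho, eps) in \bar R (+oo if no finite cover exists) *)
Definition covering_number {E : Type} (rho : E -> E -> R) (eps : R) : \bar R :=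
  ereal_inf [set (n%:R)%:E | n in
    [set n : nat | exists xs : seq E, size xs = n /\
       forall x, exists i, (i < size xs)%N /\ rho x (nth x xs i) <= eps]].

Definition upper_box_dim {E : Type} (rho : E -> E -> R) : \bar R :=
  @limf_esup R R^o R (fun eps : R^o => (lne (covering_number rho eps)
                             * ((ln (1 / eps))^-1)%:E)%E) (0%R)^'+.

(* D([0,1),E): f : R -> E (only values on [0,1) matter), piecewise constant
   with finitely many jumps, right-continuous jump convention f(t) = b *)
Definition in_D {E : Type} (f : R -> E) : Prop :=
  exists ts : seq R, (forall t, t \in ts -> 0 < t < 1) /\
    forall u v, 0 <= u -> u <= v -> v < 1 ->
      (forall t, t \in ts -> ~ (u < t <= v)) -> f u = f v.

Definition jumps {E : Type} (f : R -> E) : set R :=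
  [set t | 0 < t < 1 /\
     ~ (exists2 e, 0 < e & forall u, t - e < u < t -> f u = f t)].

Definition njumps {E : Type} (f : R -> E) : nat := #|` fset_set (jumps f) |%fset.

Definition rhoD {E : Type} (rho : E -> E -> R) (f g : R -> E) : \bar R :=
  (\int[@lebesgue_measure R]_(t in `[0%R, 1%R[) (rho (f t) (g t))%:E)%E.

(* quantization error D^(q)(r | X, rho_D, s); a codebook is a nonempty finite
   family c_0..c_n of elements of D with log (n+1) <= r *)
Definition Dq {d : measure_display} {Omega : measurableType d}
  {E : Type} (P : probability Omega R) (rho : E -> E -> R)
  (X : Omega -> R -> E) (s r : R) : \bar R :=
  ereal_inf [set e | exists (n : nat) (c : 'I_n.+1 -> R -> E),
    [/\ (forall i, in_D (c i)), ln (n.+1)%:R <= r &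
      e = poweR (\int[P]_w poweR (\big[Order.min/+oo%E]_(i < n.+1)
                                     rhoD rho (X w) (c i)) s) s^-1 ]].

End Defs.

(* Main.v *)
(** Give paths with [k] jumps the target distortion [exp (- (a - k B))]. Rounding the
    jump times to a grid of mesh about [exp (- (a - k B)) / k] and the values to a net of
    [E] reaches it, up to a constant, with about [exp ((1 + gamma) k (a - k B))]
    codewords; for [k >= a / B] any codeword will do. Since
    [sum_k lambda^k / k! * exp (s k B) = exp (lambda exp (s B))], the resulting error is
    at most a constant times [exp (- a + lambda exp (s B) / s)], while the codebook size
    is governed by [max_k k (a - k B) = a^2 / (4 B)]. The choice [B = ln r / (2 s)] makes
    [exp (s B) = sqrt r] negligible against [a] and lets [a] be as large as
    [sqrt (2 r ln r / (s (1 + gamma)))].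

    On subsets that are not measurable, [P] carries no information, so the number of jumps
    must be shown to be measurable: it is at least [k] iff the path takes different values
    at consecutive points of some rational chain of length [k]. *)
Require Import Defs.
From HB Require Import structures.
From mathcomp Require Import all_boot all_order all_algebra.
From mathcomp Require Import finmap.
From mathcomp Require Import all_classical all_reals all_analysis.
From mathcomp Require Import measurable_realfun ring lra.
Import Order.TTheory GRing.Theory Num.Theory.
Local Open Scope classical_set_scope.
Local Open Scope ring_scope.

(** * Piecewise constant paths and their jumps *)

(** To the left of a time [t] outside [ts] the path is constant back to the preceding entry of [ts],
    or back to 0, so [t] cannot be a jump. *)
Lemma jumps_sub (R : realType) (E : Type) (f : R -> E) (ts : seq R) :
  (forall t, t \in ts -> 0 < t < 1) ->
  (forall u v, 0 <= u -> u <= v -> v < 1 ->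
      (forall t, t \in ts -> ~ (u < t <= v)) -> f u = f v) ->
  jumps f `<=` [set` ts].
Proof.
move=> ts01 fts t [/andP[t0 t1] tjump] /=; apply: contrapT => /negP tNts.
apply: tjump.
pose m := \big[Order.max/0]_(x <- ts | x < t) x.
have mt : m < t by apply: (big_ind (fun z => z < t)) => // a b at_ bt; rewrite gt_max at_.
exists (t - m); first by rewrite subr_gt0.
move=> u /andP[]; rewrite opprB addrCA subrr addr0 => mu ut.
apply: fts => //; first by apply: le_trans (ltW mu); exact: bigmax_ge_id.
  exact: ltW.
move=> x xts /andP[ux]; rewrite le_eqVlt => /orP[/eqP xt|xt].
  by rewrite xt (negPf tNts) in xts.
have : x <= m by rewrite /m; apply: le_bigmax_seq.
by rewrite leNgt (lt_trans mu ux).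
Qed.

Lemma finite_jumps (R : realType) (E : Type) (f : R -> E) :
  in_D f -> finite_set (jumps f).
Proof.
by move=> [ts [ts01 fts]]; apply: sub_finite_set (jumps_sub _ _ _ _ ts01 fts) _.
Qed.

(** The list [ts] given by [in_D] may contain times that are not jumps. The induction is on the
    number of its entries in []u, v]]: the largest one, not being a jump, can be passed to the left
    without changing the value. *)
Lemma in_D_const (R : realType) (E : Type) (f : R -> E) (u v : R) :
  in_D f -> 0 <= u -> u <= v -> v < 1 ->
  (forall t, u < t <= v -> ~ jumps f t) -> f u = f v.
Proof.
move=> [ts [ts01 fts]] u0.
have [n] := ubnP (count (fun t => u < t <= v) ts).
elim: n v => // n IH v; rewrite ltnS => cn uv v1 nojump.
have [/hasP[x xts uxv]|/hasPn no] := boolP (has (fun t => u < t <= v) ts); last first.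
  by apply: fts => // t /no /negP.
pose m := \big[Order.max/x]_(x <- ts | u < x <= v) x.
have [mts umv] : m \in ts /\ u < m <= v.
  rewrite /m big_seq_cond; apply: (big_ind (fun z => z \in ts /\ u < z <= v)) => //.
    by move=> a b ? ?; rewrite /Order.max; case: ifP.
  by move=> i /andP[].
have mmax y : y \in ts -> u < y <= v -> y <= m.
  by move=> yts uyv; rewrite /m; apply: le_bigmax_seq.
have /andP[um mv] := umv.
have fmv : f m = f v.
  apply: fts => //; first exact: le_trans u0 (ltW um).
  move=> t tts /andP[mt tv]; have := mmax t tts; rewrite (lt_trans um mt) tv.
  by move=> /(_ isT); rewrite leNgt mt.
have := nojump m umv => /not_andP[|].
  by move=> []; exact: ts01.
move=> /contrapT [e e0 he].
(* A point of the left neighbourhood on which [f] equals [f m], kept at or above [u]. As [u' < m],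
   the entry [m] drops out of the count. *)
pose u' := Num.max u (m - e / 2).
have u'm : u' < m by rewrite /u' gt_max um /=; lra.
have uu' : u <= u' by rewrite /u' le_max lexx.
have fu' : f u' = f m.
  apply: he; rewrite u'm andbT.
  have : m - e / 2 <= u' by rewrite /u' le_max lexx orbT.
  by move=> ?; lra.
rewrite -fmv -fu'; apply: IH => //.
- apply: leq_trans cn; rewrite -!size_filter.
  have -> : [seq t <- ts | u < t <= u'] = [seq t <- [seq t <- ts | u < t <= v] | t <= u'].
    rewrite -filter_predI; apply: eq_filter => t /=.
    case: (u < t) => //=; rewrite ?andbF ?andbT//.
    have [tu'|] := boolP (t <= u') => //=.
    by rewrite (le_trans tu')// (le_trans (ltW u'm)).
  rewrite size_filter -[leqRHS](count_predC (fun t => t <= u')) -addn1 leq_add2l.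
  rewrite -has_count; apply/hasP; exists m; first by rewrite mem_filter umv mts.
  by rewrite /= -ltNge.
- by apply: lt_le_trans u'm _; apply: ltW; apply: le_lt_trans mv _.
- move=> t /andP[ut tu']; apply: nojump; rewrite ut /=.
  by rewrite (le_trans tu')// (le_trans (ltW u'm)).
Qed.

(** [fset_set] sends an infinite set to the empty one, so this list is faithful only when the jumps
    are finite in number, as [in_D] ensures. *)
Definition jump_seq {R : realType} {E : Type} (f : R -> E) : seq R :=
  sort <=%O (fset_set (jumps f)).

Lemma size_jump_seq (R : realType) (E : Type) (f : R -> E) :
  size (jump_seq f) = njumps f.
Proof. by rewrite /jump_seq size_sort. Qed.

Lemma mem_jump_seq (R : realType) (E : Type) (f : R -> E) (t : R) :
  in_D f -> t \in jump_seq f <-> jumps f t.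
Proof.
move=> fD; rewrite /jump_seq mem_sort in_fset_set; last exact: finite_jumps.
by split; rewrite inE.
Qed.

Lemma jump_seq_path (R : realType) (E : Type) (f : R -> E) :
  in_D f -> path <%O 0 (jump_seq f).
Proof.
move=> fD; rewrite path_min_sorted.
  by rewrite sort_lt_sorted fset_uniq.
by apply/allP => t /(mem_jump_seq _ _ _ _ fD) [/andP[]].
Qed.

(** This puts [f] in the folded form of [step_fun], so that a path and its codeword can be compared
    jump by jump. *)
Lemma foldl_jump_seq (R : realType) (E : Type) (f : R -> E) (t : R) :
  in_D f -> 0 <= t < 1 ->
  foldl (fun acc x => if x <= t then f x else acc) (f 0) (jump_seq f) = f t.
Proof.
move=> fD /andP[t0 t1].
(* The induction needs an arbitrary starting time [u], with [J] containing all jumps in []u, t]];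
   entries beyond [t] leave the accumulator unchanged. *)
suff H (J : seq R) (u : R) : 0 <= u <= t -> path <%O u J ->
    (forall x, u < x <= t -> jumps f x -> x \in J) ->
    foldl (fun acc x => if x <= t then f x else acc) (f u) J = f t.
  apply: H; rewrite ?lexx//; first exact: jump_seq_path.
  by move=> x _ /(mem_jump_seq _ _ _ _ fD).
elim: J u => [|x J IH] u /andP[u0 ut] /=.
  move=> _ hJ; apply: in_D_const => // y uy yj.
  by have := hJ y uy yj.
move=> /andP[ux xJ] hJ; case: ifPn => [xt|].
  apply: IH => //; first by rewrite xt (le_trans u0 (ltW ux)).
  move=> y /andP[xy yt] yj; have := hJ y; rewrite (lt_trans ux xy) yt.
  by move=> /(_ isT yj); rewrite inE gt_eqF.
rewrite -ltNge => tx; apply: IH; first by rewrite u0.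
  by case: J xJ {hJ} => //= y J /andP[xy ->]; rewrite (lt_trans ux xy).
move=> y /andP[uy yt] yj; have := hJ y; rewrite uy yt => /(_ isT yj).
by rewrite inE lt_eqF// (le_lt_trans yt tx).
Qed.

(** * Measurability of the number of jumps *)

Fixpoint changes {R : realType} {E : Type} (f : R -> E) (q : rat) (qs : seq rat) :
    Prop :=
  if qs is q' :: qs' then
    [/\ q < q', (ratr q' : R) < 1, f (ratr q) <> f (ratr q') & changes f q' qs']
  else True.

(** By [in_D_const] each link []q, q']] of the chain contains a jump; the links are disjoint, so
    these jumps are strictly increasing. *)
Lemma changes_jumps (R : realType) (E : Type) (f : R -> E) (q : rat) (qs : seq rat) :
  in_D f -> 0 <= q -> changes f q qs ->
  exists ts, [/\ size ts = size qs, path <%O (ratr q : R) ts &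
                 forall t, t \in ts -> jumps f t].
Proof.
move=> fD; elim: qs q => [|q' qs IH] q q0 /=; first by exists [::].
move=> [qq' q'1 fqq' /IH [|ts [sts pts tsj]]]; first exact: le_trans q0 (ltW qq').
have [t [/andP[qt tq'] tj]] : exists t, ratr q < t <= ratr q' /\ jumps f t.
  apply: contrapT => /forallNP no; apply: fqq'; apply: in_D_const => //.
  - by rewrite ler0q.
  - by rewrite ler_rat ltW.
  - by move=> t tqq' tj; apply: (no t).
exists (t :: ts); split; [by rewrite /= sts| |].
- rewrite /= qt /=; case: ts pts {sts tsj} => //= x ts /andP[q'x ->].
  by rewrite (le_lt_trans tq' q'x).
- by move=> x; rewrite inE => /orP[/eqP ->|/tsj].
Qed.

(** A rational is chosen after each jump [x] and before the next one. If the values at the chosen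
    points on both sides of [x] agreed, [f] would be constant on a left neighbourhood of [x] with
    value [f x], and [x] would not be a jump. *)
Lemma jumps_changes (R : realType) (E : Type) (f : R -> E) (q : rat) (J : seq R) :
  in_D f -> 0 <= q -> path <%O (ratr q : R) J ->
  (forall t, t \in J -> jumps f t) ->
  (forall t, ratr q < t -> jumps f t -> t \in J) ->
  exists2 qs, size qs = size J & changes f q qs.
Proof.
move=> fD; elim: J q => [|x J IH] q q0 /=; first by exists [::].
move=> /andP[qx xJ] Jj jJ.
have xj : jumps f x by apply: Jj; rewrite inE eqxx.
have [/andP[x0 x1] xjump] := xj.
(* The next jump, or the right end 1 of the domain when [x] is the last jump. *)
pose m := head 1 J.
have xm : x < m by rewrite /m; case: J xJ {IH Jj jJ m} => //= y J /andP[].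
have m1 : m <= 1.
  rewrite /m; case: J Jj {IH xJ jJ m xm} => //= y J /(_ y).
  by rewrite !inE eqxx orbT => /(_ isT) [/andP[_ /ltW]].
have [q'] := rat_in_itvoo xm; rewrite in_itv /= => /andP[xq' q'm].
have qq' : q < q' by rewrite -(ltr_rat R) (lt_trans qx xq').
have Jq' : path <%O (ratr q' : R) J.
  by move: q'm; rewrite /m; case: J xJ {IH Jj jJ m xm m1} => //= y J /andP[_ ->] ->.
have [||||qs sqs cqs] := IH q' => //.
- exact: le_trans q0 (ltW qq').
- by move=> t tJ; apply: Jj; rewrite inE tJ orbT.
- move=> t q't tj; have := jJ t; rewrite (lt_trans qx (lt_trans xq' q't)).
  by move=> /(_ isT tj); rewrite inE gt_eqF// (lt_trans xq' q't).
exists (q' :: qs); rewrite /= ?sqs//; split => //; first exact: lt_le_trans q'm m1.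
have fxq' : f x = f (ratr q').
  apply: in_D_const => //; [exact: ltW|exact: ltW|exact: lt_le_trans q'm m1|].
  move=> t /andP[xt tq'] tj; have := jJ t (lt_trans qx xt) tj.
  rewrite inE gt_eqF//= => tJ.
  have /allP/(_ t tJ) := order_path_min lt_trans Jq'.
  by rewrite ltNge tq'.
rewrite -fxq' => fqx; apply: xjump; exists (x - ratr q); first by rewrite subr_gt0.
move=> u; rewrite opprB addrCA subrr addr0 => /andP[qu ux].
rewrite -fqx; apply/esym; apply: in_D_const => //; [by rewrite ler0q|exact: ltW| |].
  exact: lt_trans ux x1.
move=> t /andP[qt tu] /(jJ t qt); rewrite inE lt_eqF ?(le_lt_trans tu ux)//= => tJ.
have /allP/(_ t tJ) := order_path_min lt_trans xJ.
by rewrite ltNge ltW// (le_lt_trans tu ux).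
Qed.

Lemma leq_njumps (R : realType) (E : Type) (f : R -> E) (k : nat) :
  in_D f -> (k <= njumps f)%N <-> exists qs, (k <= size qs)%N /\ changes f 0 qs.
Proof.
move=> fD; split=> [kn|[qs [kq /(changes_jumps _ _ _ _ _ fD) [//|ts [sts pts tsj]]]]].
  have [|||qs sqs cqs] := jumps_changes _ _ f 0 (jump_seq f) fD (lexx _).
  - by rewrite rmorph0; exact: jump_seq_path.
  - by move=> t /(mem_jump_seq _ _ _ _ fD).
  - by move=> t _ /(mem_jump_seq _ _ _ _ fD).
  by exists qs; rewrite sqs size_jump_seq.
apply: leq_trans kq _; rewrite -sts -size_jump_seq; apply: uniq_leq_size.
  by apply: (sorted_uniq lt_trans ltxx); exact: path_sorted pts.
by move=> t /tsj /(mem_jump_seq _ _ _ _ fD).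
Qed.

(** Inequality of two values is detected through [rho], which is jointly measurable and vanishes
    exactly on the diagonal. *)
Lemma measurable_changes (R : realType) (dE : measure_display) (E : measurableType dE)
  (rho : E -> E -> R) (d : measure_display) (Omega : measurableType d)
  (X : Omega -> R -> E) (q : rat) (qs : seq rat) :
  distortion rho ->
  (forall t, 0 <= t < 1 -> measurable_fun setT (fun w => X w t)) ->
  0 <= q -> (ratr q : R) < 1 -> measurable [set w | changes (X w) q qs].
Proof.
move=> [mrho _ _ rho0] mX; elim: qs q => [|q' qs IH] q q0 q1 /=.
  by rewrite [X in measurable X](_ : _ = setT)//; apply/seteqP; split.
have [qq'|qq'] := boolP (q < q'); last first.
  by rewrite [X in measurable X](_ : _ = set0)//; apply/seteqP; split => // w /= [].
have [q'1|q'1] := boolP ((ratr q' : R) < 1); last first.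
  by rewrite [X in measurable X](_ : _ = set0)//; apply/seteqP; split => // w /= [].
have q'0 : 0 <= q' by exact: le_trans q0 (ltW qq').
rewrite [X in measurable X](_ : _ =
  ~` ((fun w => rho (X w (ratr q)) (X w (ratr q'))) @^-1` [set 0])
  `&` [set w | changes (X w) q' qs]); last first.
  apply/seteqP; split => w /= => [[_ _ fqq' cqs]|[fqq' cqs]]; split => //.
    by move=> /rho0.
  by move=> fE; apply: fqq'; apply/rho0.
apply: measurableI; last exact: IH.
apply: measurableC; rewrite -[X in measurable X]setTI.
have m2 : measurable_fun setT (fun w => (X w (ratr q), X w (ratr q'))).
  by apply: measurable_fun_pair; apply: mX; rewrite ler0q ?q0 ?q'0.
exact: (measurableT_comp mrho m2 measurableT (measurable_set1 0)).
Qed.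

Lemma measurable_njumps (R : realType) (dE : measure_display) (E : measurableType dE)
  (rho : E -> E -> R) (d : measure_display) (Omega : measurableType d)
  (X : Omega -> R -> E) (k : nat) :
  distortion rho -> (forall w, in_D (X w)) ->
  (forall t, 0 <= t < 1 -> measurable_fun setT (fun w => X w t)) ->
  measurable [set w | njumps (X w) = k].
Proof.
move=> rhoP XD mX.
have mge j : measurable [set w | (j <= njumps (X w))%N].
  rewrite [X in measurable X](_ : _ =
    \bigcup_(qs : seq rat) [set w | (j <= size qs)%N /\ changes (X w) 0 qs]).
    apply: countable_bigcupT_measurable => // qs.
    have [jq|jq] := boolP (j <= size qs)%N; last first.
      by rewrite [X in measurable X](_ : _ = set0)//; apply/seteqP; split => // w /= [].
    rewrite [X in measurable X](_ : _ = [set w | changes (X w) 0 qs]).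
      by apply: (measurable_changes _ _ _ rho) => //; rewrite rmorph0 ltr01.
    by apply/seteqP; split => // w [].
  apply/seteqP; split => w /=.
    by move=> /(leq_njumps _ _ _ _ (XD w)) [qs ?]; exists qs.
  by move=> [qs _ ?]; apply/(leq_njumps _ _ _ _ (XD w)); exists qs.
rewrite [X in measurable X](_ : _ = [set w | (k <= njumps (X w))%N]
   `\` [set w | (k.+1 <= njumps (X w))%N]); first exact: measurableD.
apply/seteqP; split => w /= => [->|[k1 /negP]]; first by rewrite leqnn ltnn.
by rewrite -leqNgt => k2; apply/eqP; rewrite eqn_leq k1 k2.
Qed.

(** * Distortion between paths and step-function codewords *)

(** The integral of a nonnegative function is a supremum over the simple functions below it, so
    monotonicity holds without measurability. This matters because neither the distortion of two
    paths as a function of time nor the minimum over a codebook is shown to be measurable. *)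
Lemma ge0_le_integral_dom (d : measure_display) (T : measurableType d) (R : realType)
  (mu : {measure set T -> \bar R}) (D : set T) (f g : T -> \bar R) :
  (forall x, D x -> 0 <= f x)%E -> (forall x, D x -> f x <= g x)%E ->
  (\int[mu]_(x in D) f x <= \int[mu]_(x in D) g x)%E.
Proof.
move=> f0 fg; rewrite !ge0_integralE//; last first.
  by move=> x Dx; apply: le_trans (fg x Dx); exact: f0.
apply: ereal_sup_le => _ /= [h hf <-]; exists h => // x.
apply: le_trans (hf x) _; rewrite /patch; case: ifPn => //.
by rewrite inE => /fg.
Qed.

Lemma rhoD_ge0 (R : realType) (E : Type) (rho : E -> E -> R) (f g : R -> E) :
  (forall x y, 0 <= rho x y) -> (0 <= rhoD rho f g)%E.
Proof. by move=> rho0; apply: integral_ge0 => t _; rewrite lee_fin. Qed.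

Lemma rhoD_le_bound (R : realType) (E : Type) (rho : E -> E -> R) (W : R) (f g : R -> E) :
  (forall x y, 0 <= rho x y) -> (forall x y, rho x y <= W) ->
  (rhoD rho f g <= W%:E)%E.
Proof.
move=> rho0 rhoW; rewrite /rhoD.
have -> : W%:E = (\int[@lebesgue_measure R]_(t in `[0%R, 1%R[) (cst W%:E) t)%E.
  rewrite integral_cst//= lebesgue_measure_itv/= lte_fin ltr01 oppr0 adde0.
  by rewrite mule1.
by apply: ge0_le_integral_dom => t _ /=; rewrite lee_fin.
Qed.

(** Among the pairs whose time is at most [t], the last in list order wins, so jumps rounded to the
    same time cause no conflict. *)
Definition step_fun {R : realType} {E : Type} (x0 : E) (ps : seq (R * E)) (t : R) : E :=
  foldl (fun acc p => if p.1 <= t then p.2 else acc) x0 ps.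

Lemma in_D_step_fun (R : realType) (E : Type) (x0 : E) (ps : seq (R * E)) :
  in_D (step_fun x0 ps).
Proof.
exists [seq t <- map fst ps | 0 < t < 1]; split.
  by move=> t; rewrite mem_filter => /andP[].
move=> u v u0 uv v1; rewrite /step_fun; elim: ps x0 => //= p ps IH x0 no.
have -> : (p.1 <= u) = (p.1 <= v).
  apply/idP/idP => [pu|pv]; first exact: le_trans uv.
  rewrite leNgt; apply/negP => up; apply: (no p.1); rewrite ?up//.
  by rewrite (le_lt_trans u0 up) (le_lt_trans pv v1) inE eqxx.
apply: IH => t tps; apply: no; case: ifP => // _.
by rewrite inE tps orbT.
Qed.

(** Outside the intervals [[x, rnd x[] with [x] a jump, the codeword has made the same jumps as [f]
    and the distortion is at most [eps]. On these intervals, whose lengths add up to at most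
    [njumps f] times [del], it is at most [W]. *)
Lemma rhoD_step_fun (R : realType) (E : Type) (rho : E -> E -> R) (W eps del : R)
  (f : R -> E) (h : E -> E) (rnd : R -> R) :
  (forall x y, 0 <= rho x y) -> (forall x y, rho x y <= W) -> 0 <= del ->
  in_D f -> (forall x, rho x (h x) <= eps) ->
  (forall t, 0 <= t < 1 -> t < rnd t <= t + del) ->
  (rhoD rho f (step_fun (h (f 0%R)) [seq (rnd t, h (f t)) | t <- jump_seq f])
    <= (eps + W * (njumps f)%:R * del)%:E)%E.
Proof.
move=> rho0 rhoW del0 fD hE rndE.
have W0 : 0 <= W by apply: le_trans (rho0 (f 0) (f 0)) _.
have eps0 : 0 <= eps by apply: le_trans (rho0 (f 0) (h (f 0))) _.
set g := step_fun _ _.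
set J := jump_seq f.
have J01 x : x \in J -> 0 <= x < 1.
  by move=> /(mem_jump_seq _ _ _ _ fD) [/andP[/ltW -> ->]].
have pointwise (t : R) : 0 <= t < 1 ->
    ((rho (f t) (g t))%:E <=
      eps%:E + \sum_(x <- J) (W%:E * (\1_(`[x, rnd x[%classic : set R) t)%:E))%E.
  move=> t01.
  have [/hasP[x xJ /andP[xt trx]]|/hasPn no] := boolP (has (fun x => x <= t < rnd x) J).
    apply: le_trans (_ : (W%:E <= _)%E); first by rewrite lee_fin.
    rewrite -[leLHS]add0e; apply: leeD; first by rewrite lee_fin.
    rewrite (big_rem x)//= indicE mem_set ?mule1; last by rewrite /= in_itv/= xt trx.
    rewrite leeDl// sume_ge0// => y _; rewrite -EFinM lee_fin mulr_ge0//.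
  rewrite -[leLHS]adde0; apply: leeD; last first.
    by rewrite sume_ge0// => y _; rewrite -EFinM lee_fin mulr_ge0.
  rewrite lee_fin -(foldl_jump_seq _ _ _ _ fD t01) /g /step_fun -/J.
  (* Outside the bad intervals, [x] and [rnd x] lie on the same side of [t]. Both folds therefore
     update at the same jumps, and accumulators within [eps] of each other stay so. *)
  have {}no x : x \in J -> (rnd x <= t) = (x <= t).
    move=> xJ; have := no x xJ; rewrite negb_and -ltNge -leNgt.
    have /andP[xr _] := rndE x (J01 x xJ).
    move=> /orP[tx|rt]; last by rewrite rt (le_trans (ltW xr) rt).
    by rewrite leNgt (lt_trans tx xr) leNgt tx.
  have : rho (f 0) (h (f 0)) <= eps by [].
  move: (f 0) (h (f 0)); elim: J no {J01} => //= x J IH no a b ab.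
  rewrite no ?mem_head//; apply: IH => [y yJ|]; last by case: ifP.
  by rewrite no// inE yJ orbT.
rewrite /rhoD.
apply: (@le_trans _ _ (\int[@lebesgue_measure R]_(t in `[0%R, 1%R[)
   (eps%:E + \sum_(x <- J) (W%:E * (\1_(`[x, rnd x[%classic : set R) t)%:E)))%E).
  apply: ge0_le_integral_dom => t; first by rewrite lee_fin.
  by rewrite /= in_itv/= => t01; exact: pointwise.
pose F (x : R) : R -> \bar R :=
  fun t => (W%:E * (\1_(`[x, rnd x[%classic : set R) t)%:E)%E.
have mind x : measurable_fun (`[0%R, 1%R[ : set R) (F x).
  apply: emeasurable_funM => //; apply/measurable_EFinP.
  by apply: measurable_indic.
rewrite ge0_integralD//; last 2 first.
- by move=> t _; rewrite sume_ge0// => y _; rewrite -EFinM lee_fin mulr_ge0.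
- exact: emeasurable_sum.
rewrite [X in (X + _)%E]integral_cst//= lebesgue_measure_itv/= lte_fin ltr01 oppr0 adde0.
rewrite mule1 EFinD leeD2lE// ge0_integral_sum//; last first.
  by move=> x t _; rewrite -EFinM lee_fin mulr_ge0.
rewrite -size_jump_seq -/J.
apply: (@le_trans _ _ (\sum_(x <- J) (W * del)%:E)%E); last first.
  rewrite sumEFin lee_fin big_const_seq count_predT iter_addr_0.
  by rewrite mulrAC mulr_natr.
rewrite big_seq [leRHS]big_seq; apply: lee_sum => x xJ.
rewrite ge0_integralZl_EFin//; last first.
  by apply/measurable_EFinP; exact: measurable_indic.
rewrite integral_indic// EFinM; apply: lee_pmul => //.
(* [rnd x] may lie beyond 1, so the part of the interval inside [[0, 1[] is bounded by its full
   length. *)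
apply: (@le_trans _ _ (lebesgue_measure (`[x, rnd x[%classic : set R))).
  by apply: le_measure; rewrite ?inE//; exact: measurableI.
have /andP[xr rx] := rndE x (J01 x xJ).
by rewrite lebesgue_measure_itv/= lte_fin xr -EFinD lee_fin lerBlDl.
Qed.

(* The index pair [(j, i)] stands for a jump at time [(j + 1) / (m + 1)] to the [i]-th
   point of the net; the first pair only carries the initial value. *)
Definition grid_code {R : realType} {E : Type} (x0 : E) (m : nat) (xs : seq E)
    (p : seq ('I_m.+1 * 'I_(size xs))) : R -> E :=
  if p is q :: p' then
    step_fun (nth x0 xs q.2)
      [seq (q.1.+1%:R / m.+1%:R, nth x0 xs q.2) | q : 'I_m.+1 * 'I_(size xs) <- p']
  else step_fun x0 [::].

Lemma in_D_grid_code (R : realType) (E : Type) (x0 : E) (m : nat) (xs : seq E)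
  (p : seq ('I_m.+1 * 'I_(size xs))) : in_D (@grid_code R E x0 m xs p).
Proof. by case: p => [|q p]; exact: in_D_step_fun. Qed.

(** Each jump is moved to the first grid time strictly to its right, at distance at most
    [1 / (m + 1)], and each value to a net point. *)
Lemma grid_code_approx (R : realType) (E : Type) (rho : E -> E -> R) (W eps : R)
  (x0 : E) (m : nat) (xs : seq E) (f : R -> E) :
  (forall x y, 0 <= rho x y) -> (forall x y, rho x y <= W) -> in_D f ->
  (forall x, exists i, (i < size xs)%N /\ rho x (nth x xs i) <= eps) ->
  exists p : (njumps f).+1.-tuple ('I_m.+1 * 'I_(size xs)),
    (rhoD rho f (grid_code x0 m xs p) <= (eps + W * (njumps f)%:R / m.+1%:R)%:E)%E.
Proof.
move=> rho0 rhoW fD net.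
have /choice[ix ixE] : forall x, exists i : 'I_(size xs), rho x (nth x0 xs i) <= eps.
  move=> x; have [i [isz ri]] := net x; exists (Ordinal isz) => /=.
  by rewrite (set_nth_default x).
pose jx (t : R) : 'I_m.+1 := inord (Num.truncn (m.+1%:R * t)).
pose s := (jx 0, ix (f 0)) :: [seq (jx t, ix (f t)) | t <- jump_seq f].
have ss : size s == (njumps f).+1 by rewrite /= size_map size_jump_seq.
exists (Tuple ss).
pose rnd (t : R) : R := (jx t).+1%:R / m.+1%:R.
rewrite /= -map_comp.
apply: (rhoD_step_fun _ _ rho W eps _ f (fun x => nth x0 xs (ix x)) rnd) => //.
move=> t /andP[t0 t1].
have mt0 : 0 <= m.+1%:R * t by rewrite mulr_ge0.
(* Since [t < 1], the truncation is at most [m], so [inord] does not fall back on its default. *)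
have jxE : jx t = Num.truncn (m.+1%:R * t) :> nat.
  by rewrite /jx inordK// truncn_lt_nat// -[ltRHS]mulr1 ltr_pM2l.
rewrite /rnd jxE ltr_pdivlMr// mulrC truncnS_gt/=.
rewrite ler_pdivrMr// mulrDl mulVf// -natr1 lerD2r [t * _]mulrC.
by rewrite truncn_le.
Qed.

(** * Nets from the upper box dimension *)

(** The upper limit controls covering numbers only near 0. Using the radius [eps1 * expR (- l)] with
    a fixed small [eps1] makes the estimate valid for every [l >= 0], at the price of the constant
    [C]. *)
Lemma box_dim_net (R : realType) (E : Type) (rho : E -> E -> R) (gamma g : R) :
  upper_box_dim rho = gamma%:E -> gamma < g ->
  exists2 C : R, 0 <= C & forall l : R, 0 <= l -> exists xs : seq E,
    (size xs)%:R <= expR (C + g * l) /\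
    forall x, exists i, (i < size xs)%N /\ rho x (nth x xs i) <= expR (- l).
Proof.
move=> dimE gg.
have : (upper_box_dim rho < g%:E)%E by rewrite dimE lte_fin.
move=> /ereal_inf_lt[_ [A [e /= e0 eA] <-] supA].
(* The bound [e / 2] keeps every radius [u] inside [A]; the bound [expR (-1)] makes [ln (1 / u)]
   positive. *)
pose eps1 := Num.min (e / 2) (expR (-1)).
have eps1_gt0 : 0 < eps1 by rewrite lt_min expR_gt0 divr_gt0.
have eps1_lt1 : eps1 < 1 by rewrite gt_min expR_lt1 ltrN10 orbT.
pose L1 := - ln eps1.
have L1_gt0 : 0 < L1 by rewrite oppr_gt0 ln_lt0// eps1_gt0.
exists (`|g| * L1); first by rewrite mulr_ge0// ltW.
move=> l l0; pose u := eps1 * expR (- l).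
have u0 : 0 < u by rewrite mulr_gt0// expR_gt0.
have ule : u <= eps1 by rewrite ler_piMr ?(ltW eps1_gt0)// expR_le1 oppr_le0.
have Au : A u.
  apply: eA => //=; rewrite sub0r normrN gtr0_norm//.
  apply: (le_lt_trans ule); rewrite gt_min; apply/orP; left.
  by rewrite ltr_pdivrMr// ltr_pMr// ltr1n.
have lnu : ln (1 / u) = L1 + l.
  by rewrite div1r lnV ?posrE// lnM ?posrE ?expR_gt0// expRK opprD opprK.
have Ll : 0 < L1 + l by rewrite ltr_wpDr.
have /le_lt_trans/(_ supA) : (lne (covering_number rho u) * ((ln (1 / u))^-1)%:E
    <= ereal_sup [set (lne (covering_number rho eps) * ((ln (1 / eps))^-1)%:E)%E
                 | eps in A])%E.
  by apply: ereal_sup_ubound; exists u.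
rewrite lnu lte_pdivrMr// -EFinM => lneN.
have N0 : (0 <= covering_number rho u)%E.
  by apply: le_ereal_inf_tmp => _ [n _ <-]; rewrite lee_fin.
have : (covering_number rho u < (expR (g * (L1 + l)))%:E)%E.
  rewrite ltNge; apply/negP => leN; move: lneN; apply/negP; rewrite -leNgt.
  rewrite -[leLHS](_ : lne (expR (g * (L1 + l)))%:E = _); last first.
    by rewrite lne_EFin ?expR_gt0// expRK.
  by rewrite lee_lne// in_itv/= ?leey ?andbT// lee_fin expR_ge0.
move=> /ereal_inf_lt[_ [_ [xs [<- net]] <-]]; rewrite lte_fin => szs.
exists xs; split.
  apply: (le_trans (ltW szs)); rewrite ler_expR mulrDr lerD2r.
  by rewrite ler_wpM2r ?(ltW L1_gt0)// ler_norm.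
move=> x; have [i [isz ri]] := net x; exists i; split => //.
apply: (le_trans ri); rewrite /u ler_piMl ?expR_ge0//; exact: ltW.
Qed.

(** A negative dimension would allow, for large [l], a net with fewer than one point, which cannot
    cover [x0]. *)
Lemma box_dim_ge0 (R : realType) (E : Type) (rho : E -> E -> R) (gamma : R) (x0 : E) :
  upper_box_dim rho = gamma%:E -> 0 <= gamma.
Proof.
move=> dimE; rewrite leNgt; apply/negP => g0.
have [|C C0 net] := box_dim_net _ _ rho gamma (gamma / 2) dimE.
  by rewrite ltr_pdivlMr//; lra.
pose l := (C + 1) / (- gamma / 2).
have l0 : 0 <= l by rewrite /l divr_ge0//; lra.
have [xs [szs /(_ x0)[i [isz _]]]] := net l l0.
have lE : C + gamma / 2 * l = -1 by rewrite /l; field; rewrite lt_eqF.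
rewrite lE in szs.
have : (size xs)%:R < 1 :> R.
  by apply: (le_lt_trans szs); rewrite expR_lt1 ltrN10.
by rewrite ltrn1; case: (size xs) isz.
Qed.

(** * From codebooks to the quantization error *)

(** [f] is dominated by the series of [phi k] times the indicator of the class [N = k], which is
    measurable and can be integrated term by term. *)
Lemma integral_le_by_classes (d : measure_display) (T : measurableType d) (R : realType)
  (mu : {measure set T -> \bar R}) (N : T -> nat) (f : T -> \bar R) (phi p : nat -> R)
  (S : R) :
  (forall k, measurable [set w | N w = k]) ->
  (forall k, mu [set w | N w = k] <= (p k)%:E)%E ->
  (forall k, 0 <= phi k) ->
  (forall w, 0 <= f w)%E -> (forall w, f w <= (phi (N w))%:E)%E ->
  (forall n, \sum_(0 <= k < n) phi k * p k <= S) ->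
  (\int[mu]_w f w <= S%:E)%E.
Proof.
move=> mN muN phi0 f0 fphi sumS.
pose F k : T -> \bar R := fun w => ((phi k)%:E * (\1_[set w | N w = k] w)%:E)%E.
have F0 k w : (0 <= F k w)%E by rewrite /F -EFinM lee_fin mulr_ge0.
have mF k : measurable_fun setT (F k).
  apply: emeasurable_funM => //; apply/measurable_EFinP.
  exact: measurable_indic.
apply: (@le_trans _ _ (\int[mu]_w (\sum_(k <oo) F k w))%E).
  apply: ge0_le_integral_dom => // w _; apply: (le_trans (fphi w)).
  apply: (@le_trans _ _ (\sum_(0 <= k < (N w).+1) F k w)%E); last first.
    exact: nneseries_lim_ge.
  rewrite big_nat_recr//= {2}/F indicE mem_set// mule1.
  by rewrite leeDr// sume_ge0.
rewrite integral_nneseries//; apply: lime_le.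
  by apply: is_cvg_nneseries => n _ _; exact: integral_ge0.
apply: nearW => n; apply: le_trans (_ : ((\sum_(0 <= k < n) phi k * p k)%:E <= _)%E).
  rewrite -sumEFin; apply: lee_sum => k _.
  rewrite ge0_integralZl_EFin//; last first.
    by apply/measurable_EFinP; exact: measurable_indic.
  by rewrite integral_indic// setIT EFinM; apply: lee_wpmul2l; rewrite ?lee_fin.
by rewrite lee_fin.
Qed.

Lemma Dq_le_codebook (R : realType) (d : measure_display) (Omega : measurableType d)
  (E : Type) (P : probability Omega R) (rho : E -> E -> R) (X : Omega -> R -> E)
  (s r : R) (I : finType) (c : I -> R -> E) (phi p : nat -> R) (S : R) :
  0 < s -> (forall x y, 0 <= rho x y) -> (forall w, in_D (X w)) ->
  (forall k, measurable [set w | njumps (X w) = k]) ->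
  (forall k, P [set w | njumps (X w) = k] <= (p k)%:E)%E ->
  (0 < #|I|)%N -> (forall i, in_D (c i)) -> ln (#|I|%:R) <= r ->
  (forall k, 0 <= phi k) ->
  (forall f, in_D f -> exists i, (rhoD rho f (c i) <= (phi (njumps f))%:E)%E) ->
  (forall n, \sum_(0 <= k < n) phi k `^ s * p k <= S) ->
  (Dq P rho X s r <= (S `^ s^-1)%:E)%E.
Proof.
move=> s0 rho0 XD mN PN I0 cD lnI phi0 capprox sumS.
have cI : #|I|.-1.+1 = #|I| by rewrite prednK.
pose c' (i : 'I_#|I|.-1.+1) := c (enum_val (cast_ord cI i)).
apply: (@le_trans _ _ (poweR (\int[P]_w poweR (\big[Order.min/+oo%E]_(i < #|I|.-1.+1)
   rhoD rho (X w) (c' i)) s) s^-1)%E).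
  apply: ereal_inf_lbound; exists #|I|.-1, c'; split => //; last by rewrite cI.
  by move=> i; exact: cD.
have min0 w : (0 <= \big[Order.min/+oo%E]_(i < #|I|.-1.+1) rhoD rho (X w) (c' i))%E.
  by apply/bigmin_geP; split => // i _; exact: rhoD_ge0.
have int_le : (\int[P]_w poweR (\big[Order.min/+oo%E]_(i < #|I|.-1.+1)
   rhoD rho (X w) (c' i)) s <= S%:E)%E.
  apply: (integral_le_by_classes _ _ _ _ (fun w => njumps (X w)) _
    (fun k => phi k `^ s) p) => //.
  - by move=> k; exact: powR_ge0.
  - by move=> w; exact: poweR_ge0.
  move=> w; rewrite -poweR_EFin; apply: gt0_ler_poweR.
  - exact: ltW.
  - by rewrite in_itv/= min0 leey.
  - by rewrite in_itv/= lee_fin phi0 leey.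
  have [i ri] := capprox _ (XD w).
  apply: le_trans ri; pose j := cast_ord (esym cI) (enum_rank i).
  have -> : c i = c' j by rewrite /c' cast_ordKV enum_rankK.
  exact: bigmin_le.
rewrite -poweR_EFin; apply: gt0_ler_poweR => //.
- by rewrite invr_ge0 ltW.
- by rewrite in_itv/= leey andbT; apply: integral_ge0 => w _; exact: poweR_ge0.
- rewrite in_itv/= leey andbT; apply: le_trans int_le.
  by apply: integral_ge0 => w _; exact: poweR_ge0.
Qed.

(** The codebook is a disjoint union of blocks, one for each [k <= M]. With [l = max 0 (a - k B)], a
    word of block [k] has [k + 1] entries, for the initial value and the jumps, each with at most
    [(M + 1) expR l] grid times and [expR (C + g l)] net points. The condition on [r] then gives
    each block at most [expR r / (M + 1)] words. *)
Lemma exists_codebook (R : realType) (E : Type) (rho : E -> E -> R) (x0 : E)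
  (W C g a B r : R) (M : nat) :
  (forall x y, 0 <= rho x y) -> (forall x y, rho x y <= W) ->
  (forall l : R, 0 <= l -> exists xs : seq E,
    (size xs)%:R <= expR (C + g * l) /\
    forall x, exists i, (i < size xs)%N /\ rho x (nth x xs i) <= expR (- l)) ->
  0 < B -> a <= M.+1%:R * B ->
  (forall k, (k <= M)%N ->
    k.+1%:R * ((1 + g) * Num.max 0 (a - k%:R * B) + C + ln M.+1%:R) + ln M.+1%:R <= r) ->
  exists (I : finType) (c : I -> R -> E),
    [/\ (0 < #|I|)%N, forall i, in_D (c i), ln (#|I|%:R) <= r &
        forall f, in_D f -> exists i,
          (rhoD rho f (c i) <= ((1 + W) * expR (- (a - (njumps f)%:R * B)))%:E)%E].
Proof.
move=> rho0 rhoW net B0 aM rE.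
have W0 : 0 <= W by apply: le_trans (rho0 x0 x0) _.
pose l (k : nat) := Num.max 0 (a - k%:R * B).
have l0 k : 0 <= l k by rewrite le_max lexx.
have /choice[xs xsE] : forall k : nat, exists xs : seq E,
    (size xs)%:R <= expR (C + g * l k) /\
    forall x, exists i, (i < size xs)%N /\ rho x (nth x xs i) <= expR (- l k).
  by move=> k; exact: net.
(* Just fine enough for [k / (m k + 1)] to be at most [expR (- l k)], the precision of the net. *)
pose m (k : nat) := Num.truncn (k%:R * expR (l k)).
have kl0 k : 0 <= k%:R * expR (l k) by rewrite mulr_ge0// expR_ge0.
pose I : finType := {k : 'I_M.+1 & k.+1.-tuple ('I_(m k).+1 * 'I_(size (xs k)))}.
pose c (u : I) : R -> E := grid_code x0 (m (tag u)) (xs (tag u)) (tagged u).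
have [i0 _] : exists i0 : I, True.
  have [_ /(_ x0)[i [isz _]]] := xsE 0%N.
  by exists (Tagged (fun k : 'I_M.+1 => k.+1.-tuple ('I_(m k).+1 * 'I_(size (xs k))))
    (nseq_tuple (ord0 : 'I_M.+1).+1 (ord0, Ordinal isz))).
have I0 : (0 < #|I|)%N by apply/card_gt0P; exists i0.
exists I, c; split => //.
- by move=> u; exact: in_D_grid_code.
- suff : #|I|%:R <= expR r.
    by move=> h; rewrite -[leRHS]expRK ler_ln// posrE ?ltr0n// expR_gt0.
  rewrite card_tagged sumnE big_map natr_sum big_enum /=.
  apply: (@le_trans _ _ (\sum_(k < M.+1) expR (r - ln M.+1%:R))); last first.
    by rewrite sumr_const card_ord expRB lnK ?posrE// -[leLHS]mulr_natr divfK.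
  apply: ler_sum => k _; rewrite card_tuple card_prod !card_ord natrX natrM.
  have kM : (k <= M)%N by rewrite -ltnS.
  have [szs _] := xsE k.
  have mk : (m k).+1%:R <= expR (ln M.+1%:R + l k).
    rewrite expRD lnK ?posrE// -natr1.
    apply: (@le_trans _ _ (k%:R * expR (l k) + expR (l k))).
      apply: lerD; first by rewrite truncn_le.
      by rewrite -expR0 ler_expR.
    by rewrite -[X in _ + X]mul1r -mulrDl natr1 ler_pM2r ?expR_gt0// ler_nat.
  apply: (@le_trans _ _ (expR (ln M.+1%:R + l k + (C + g * l k)) ^+ k.+1)).
    by rewrite lerXn2r ?nnegrE ?mulr_ge0 ?expR_ge0// expRD ler_pM.
  rewrite -expRM_natl ler_expR lerBrDr; apply: le_trans (rE k kM).
  rewrite lerD2r ler_wpM2l// -/(l k); lra.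
(* With more than [M] jumps, [a <= M.+1%:R * B] makes the allowed distortion at least [1 + W], so
   any codeword will do. *)
- move=> f fD; have [kM|kM] := ltnP (njumps f) M.+1; last first.
    exists i0; apply: (le_trans (rhoD_le_bound _ _ _ _ _ _ rho0 rhoW)).
    rewrite lee_fin; apply: (@le_trans _ _ ((1 + W) * 1)); first lra.
    apply: ler_wpM2l; first lra.
    rewrite -[leLHS]expR0 ler_expR oppr_ge0 subr_le0; apply: (le_trans aM).
    by rewrite ler_pM2r// ler_nat.
  have [p pE] := grid_code_approx _ _ rho W _ x0 (m (njumps f)) _ f rho0 rhoW fD
    (xsE (njumps f)).2.
  exists (Tagged (fun k : 'I_M.+1 => k.+1.-tuple ('I_(m k).+1 * 'I_(size (xs k))))
    (p : (Ordinal kM).+1.-tuple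
      ('I_(m (Ordinal kM)).+1 * 'I_(size (xs (Ordinal kM)))))).
  apply: (le_trans pE); rewrite lee_fin.
  apply: (@le_trans _ _ ((1 + W) * expR (- l (njumps f)))); last first.
    rewrite ler_wpM2l ?addr_ge0// ler_expR lerN2.
    by rewrite /l le_max lexx orbT.
  rewrite mulrDl mul1r lerD2l -mulrA ler_wpM2l// expRN ler_pdivrMr//.
  by rewrite ler_pdivlMl ?expR_gt0// mulrC ltW// truncnS_gt.
Qed.

Lemma probability_inhabited (d : measure_display) (T : measurableType d) (R : realType)
  (P : probability T R) : exists w : T, True.
Proof.
apply: contrapT => noT; have := @probability_setT _ _ _ P.
rewrite (_ : setT = set0) ?measure0; last first.
  by apply/seteqP; split => // w; case: noT; exists w.
by move=> /eqP; rewrite eqe eq_sym oner_eq0.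
Qed.

Lemma sum_exp_coeff_le (R : realType) (x : R) (n : nat) :
  0 <= x -> \sum_(0 <= k < n) x ^+ k / k`!%:R <= expR x.
Proof.
move=> x0; have /nondecreasing_cvgn_le := @is_cvg_series_exp_coeff R x.
by apply; apply/nondecreasing_seqP => m; rewrite !seriesEnat/= big_nat_recr//= lerDl
  divr_ge0// exprn_ge0.
Qed.

Lemma Dq_le_exp (R : realType) (s lambda K : R)
  (dE : measure_display) (E : measurableType dE) (rho : E -> E -> R)
  (d : measure_display) (Omega : measurableType d) (P : probability Omega R)
  (X : Omega -> R -> E) (W C g a B r : R) (M : nat) :
  0 < s -> 0 < lambda -> 1 <= K -> distortion rho ->
  (forall x y, rho x y <= W) -> (forall w, in_D (X w)) ->
  (forall t, 0 <= t < 1 -> measurable_fun setT (fun w => X w t)) ->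
  (forall k : nat, (P [set w | njumps (X w) = k]
      <= (lambda ^+ k / (k`!)%:R * expR (- lambda) * K)%:E)%E) ->
  (forall l : R, 0 <= l -> exists xs : seq E,
    (size xs)%:R <= expR (C + g * l) /\
    forall x, exists i, (i < size xs)%N /\ rho x (nth x xs i) <= expR (- l)) ->
  0 < B -> a <= M.+1%:R * B ->
  (forall k, (k <= M)%N ->
    k.+1%:R * ((1 + g) * Num.max 0 (a - k%:R * B) + C + ln M.+1%:R) + ln M.+1%:R <= r) ->
  (Dq P rho X s r <=
    (expR (ln (1 + W) + ln K / s + lambda * expR (s * B) / s - a))%:E)%E.
Proof.
move=> s0 lambda0 K1 rhoP rhoW XD mX PN net B0 aM rE.
have [_ _ rho0 _] := rhoP.
have [w0 _] := probability_inhabited _ _ _ P.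
pose x0 := X w0 0.
have W0 : 0 <= W by apply: le_trans (rho0 x0 x0) _.
have [I [c [I0 cD lnI capprox]]] :=
  exists_codebook _ _ rho x0 W C g a B r M rho0 rhoW net B0 aM rE.
pose phi k := (1 + W) * expR (- (a - k%:R * B)).
(* The bound on the moment of order [s], chosen so that its root of order [s] is the claimed one. *)
pose S := expR ((ln (1 + W) + ln K / s + lambda * expR (s * B) / s - a) * s).
have -> : expR (ln (1 + W) + ln K / s + lambda * expR (s * B) / s - a) = S `^ s^-1.
  by rewrite /S; set z := _ - a; rewrite expRM -powRrM divff ?gt_eqF// powRr1// expR_ge0.
have W1 : 0 < 1 + W by lra.
apply: (Dq_le_codebook _ _ _ _ _ rho X s r I c phi
  (fun k => lambda ^+ k / (k`!)%:R * expR (- lambda) * K) S) => //.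
- by move=> k; exact: (measurable_njumps _ _ _ rho).
- by move=> k; rewrite mulr_ge0 ?expR_ge0// ltW.
move=> n; pose D := expR ((ln (1 + W) - a) * s - lambda + ln K).
have termE k : phi k `^ s * (lambda ^+ k / k`!%:R * expR (- lambda) * K) =
    D * ((lambda * expR (s * B)) ^+ k / k`!%:R).
  rewrite /phi -{1}(lnK (x := 1 + W)) ?posrE// -expRD -expRM.
  rewrite -{1}(lnK (x := K)) ?posrE; last by lra.
  rewrite exprMn -expRM_natl /D.
  rewrite (_ : (ln (1 + W) + - (a - k%:R * B)) * s =
    (ln (1 + W) - a) * s + k%:R * (s * B)); last by ring.
  by rewrite !expRD; ring.
under eq_bigr do rewrite termE.
rewrite -mulr_sumr; apply: (@le_trans _ _ (D * expR (lambda * expR (s * B)))).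
  rewrite ler_wpM2l ?expR_ge0// sum_exp_coeff_le// mulr_ge0 ?expR_ge0//; exact: ltW.
(* Only the negative term [- lambda] in the exponent of [D] separates the two sides. *)
rewrite /D -expRD ler_expR.
have -> : (ln (1 + W) + ln K / s + lambda * expR (s * B) / s - a) * s =
  (ln (1 + W) - a) * s + ln K + lambda * expR (s * B) by field; rewrite gt_eqF.
by lra.
Qed.

(** * Choice of the parameters and the asymptotic rate *)

(** Completing the square. The factor is [x + 1] rather than [x] because the initial value is coded
    along with the jumps. *)
Lemma le_quadratic_max (R : realFieldType) (a B x : R) : 0 < B ->
  (x + 1) * (a - x * B) <= a ^+ 2 / (4 * B) + a / 2 + B / 4.
Proof.
move=> B0; rewrite -subr_ge0.
rewrite (_ : _ - _ = (a - (2 * x + 1) * B) ^+ 2 / (4 * B)); last first.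
  by field; rewrite gt_eqF.
by rewrite divr_ge0 ?sqr_ge0// mulr_ge0// ltW.
Qed.

(* With [B = ln r / (2 s)] the maximum over [k] of [(k + 1) (a - k B)] is about
   [a ^ 2 / (4 B) = (theta L) ^ 2 s / (2 ln r)], i.e. [theta ^ 2 r / (1 + gamma)]. *)
Lemma rate_choice (R : realType) (s lambda gamma C c0 theta1 theta : R) :
  0 < s -> 0 < lambda -> 0 <= gamma -> 0 <= C -> 0 < theta -> theta < theta1 ->
  theta1 < 1 ->
  exists r0 : R, forall r, r0 < r ->
    let L := Num.sqrt (2 / (s * (1 + gamma)) * r * ln r) in
    let g := gamma + (1 + gamma) * (1 - theta1) in
    exists (B : R) (M : nat),
    [/\ 0 < L, 0 < B, theta1 * L <= M.+1%:R * B,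
      forall k, (k <= M)%N ->
        k.+1%:R * ((1 + g) * Num.max 0 (theta1 * L - k%:R * B) + C + ln M.+1%:R)
          + ln M.+1%:R <= r &
      theta * L <= theta1 * L - lambda * expR (s * B) / s - c0].
Proof.
move=> s0 lambda0 gamma0 C0 theta0 tt1 theta1_lt1.
have s_ge0 := ltW s0.
have t1_gt0 : 0 < theta1 by exact: lt_trans tt1.
have gamma1_gt0 : 0 < 1 + gamma by exact: ltr_wpDr.
have t1C_gt0 : 0 < 1 - theta1 by rewrite subr_gt0.
have t1t_gt0 : 0 < theta1 - theta by rewrite subr_gt0.
pose A := 2 / (s * (1 + gamma)); pose sA := Num.sqrt A; pose c1 := Num.sqrt (2 * A).
have A0 : 0 < A by rewrite divr_gt0// mulr_gt0//; lra.
have sA0 : 0 < sA by rewrite sqrtr_gt0.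
have sA2 : sA ^+ 2 = A by rewrite sqr_sqrtr// ltW.
have c10 : 0 <= c1 by exact: sqrtr_ge0.
have c12 : c1 ^+ 2 = 2 * A by rewrite sqr_sqrtr//; lra.
pose g := gamma + (1 + gamma) * (1 - theta1).
have g0 : 0 <= g by rewrite addr_ge0// mulr_ge0 ?(ltW t1C_gt0)// addr_ge0.
have g1 : 0 <= 1 + g by rewrite addr_ge0.
pose c := 2 * s * sA.
have c_ge0 : 0 <= c by rewrite /c !mulr_ge0//; exact: ltW.
(* [D] collects the coefficients of all terms of order [q ^+ 3] in the log-size of the codebook, [q]
   being the fourth root of [r]; from [q0] on they fit into [(1 - theta1) * r]. *)
pose D := (1 + g) * (c1 / 2 + 1 / (4 * s)) + (c + 2) * (C + c + 3).
have D0 : 0 <= D.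
  have s4 : 0 <= 1 / (4 * s) by rewrite divr_ge0// mulr_ge0// ltW.
  by rewrite /D addr_ge0// mulr_ge0//; lra.
pose q0 := D / (1 - theta1).
have q00 : 0 <= q0 by rewrite divr_ge0// ltW.
(* Chosen so that, once [ln r] exceeds [D2 ^+ 2], the margin [(theta1 - theta) * L] absorbs both
   [lambda * expR (s * B) / s] and [c0]. *)
pose D2 := (lambda / s + `|c0|) / ((theta1 - theta) * sA).
have D20 : 0 <= D2.
  apply: divr_ge0; last by apply: mulr_ge0; exact: ltW.
  by rewrite addr_ge0// divr_ge0// ltW.
exists (Num.max (q0 ^+ 4) (expR (1 + D2 ^+ 2))) => r.
rewrite gt_max => /andP[r_q0 r_exp] L; rewrite -/g.
have r0 : 0 < r by apply: lt_trans r_exp; exact: expR_gt0.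
pose y := ln r.
have y_ge : 1 + D2 ^+ 2 < y.
  by rewrite /y -[ltLHS]expRK ltr_ln// posrE expR_gt0.
have y1 : 1 <= y by have := sqr_ge0 D2; lra.
have y0 : 0 < y by exact: lt_le_trans y1.
(* Powers of this fourth root bound every quantity: [ln r] and [M] are of order at most [q ^+ 2],
   [L] is at most of order [q ^+ 3], and [r] is [q ^+ 4]. *)
pose q := Num.sqrt (Num.sqrt r).
have q_ge0 : 0 <= q by exact: sqrtr_ge0.
have q2 : q ^+ 2 = Num.sqrt r by rewrite sqr_sqrtr// sqrtr_ge0.
have q4 : q ^+ 4 = r by rewrite (exprM q 2 2) q2 sqr_sqrtr// ltW.
have q_gt0 : 0 < q by rewrite !sqrtr_gt0.
have q1 : 1 <= q.
  rewrite -(ler_pXn2r (n := 4))// ?nnegrE// expr1n q4 ltW//; apply: le_lt_trans r_exp.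
  by rewrite -[leLHS]expR0 ler_expR addr_ge0// sqr_ge0.
have qq0 : q0 <= q by rewrite -(ler_pXn2r (n := 4))// ?nnegrE// q4 ltW.
have lnq : ln q <= q by rewrite ltW// ln_sublinear.
have yq : y = ln q *+ 4 by rewrite /y -q4 lnXn.
have y2 : y <= 2 * q ^+ 2.
  have : ln (q ^+ 2) <= q ^+ 2 by rewrite ltW// ln_sublinear// exprn_gt0.
  rewrite lnXn// => h; rewrite yq (_ : 4 = 2 + 2)%N// mulrnDr; lra.
have ey : expR (y / 2) = q ^+ 2.
  by rewrite yq -[q in RHS](lnK (x := q)) ?posrE// -expRM_natl; congr expR; field.
have L0 : 0 <= L by exact: sqrtr_ge0.
have L2 : L ^+ 2 = A * q ^+ 4 * y.
  rewrite sqr_sqrtr ?q4// -/A -/y; apply: mulr_ge0; last exact: ltW.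
  by apply: mulr_ge0; exact: ltW.
have le_sqr (u v : R) : 0 <= u -> 0 <= v -> u ^+ 2 <= v ^+ 2 -> u <= v.
  by move=> u0 v0; rewrite ler_pXn2r.
have Aq4 : 0 <= A * q ^+ 4 by rewrite mulr_ge0 ?exprn_ge0// ltW.
have L_y : L <= sA * q ^+ 2 * y.
  apply: le_sqr => //.
    by apply: mulr_ge0; [apply: mulr_ge0; [exact: ltW|exact: exprn_ge0]|exact: ltW].
  have -> : (sA * q ^+ 2 * y) ^+ 2 = A * q ^+ 4 * y ^+ 2 by rewrite -sA2; ring.
  by rewrite L2 ler_wpM2l// ler_eXnr.
have L_q3 : L <= c1 * q ^+ 3.
  apply: le_sqr => //; first by rewrite !mulr_ge0 ?exprn_ge0.
  have -> : (c1 * q ^+ 3) ^+ 2 = 2 * A * q ^+ 6 by rewrite -c12; ring.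
  rewrite L2.
  apply: (@le_trans _ _ (A * q ^+ 4 * (2 * q ^+ 2))); first by rewrite ler_wpM2l.
  by rewrite le_eqVlt; apply/orP; left; apply/eqP; ring.
have L_D2 : sA * q ^+ 2 * D2 <= L.
  apply: le_sqr => //.
    by apply: mulr_ge0 => //; apply: mulr_ge0; [exact: ltW|exact: exprn_ge0].
  have -> : (sA * q ^+ 2 * D2) ^+ 2 = A * q ^+ 4 * D2 ^+ 2 by rewrite -sA2; ring.
  by rewrite L2 ler_wpM2l//; lra.
pose B := y / (2 * s).
have B0 : 0 < B by rewrite divr_gt0// mulr_gt0.
pose a := theta1 * L.
have a0 : 0 <= a by rewrite mulr_ge0// ltW.
have aL : a <= L by rewrite ler_piMl// ltW.
have aB0 : 0 <= a / B by rewrite divr_ge0// ltW.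
(* With this choice [a - k B] is nonnegative exactly for [k <= M]. *)
pose M := Num.truncn (a / B).
have /andP[MaB aBM] := truncn_itv aB0; rewrite -/M in MaB aBM.
have L_gt0 : 0 < L.
  by rewrite sqrtr_gt0 -/A -/y; apply: mulr_gt0; [exact: mulr_gt0|].
have Mc : M%:R <= c * q ^+ 2.
  apply: (le_trans MaB); rewrite ler_pdivrMr//; apply: (le_trans aL).
  apply: (le_trans L_y); rewrite /c /B le_eqVlt; apply/orP; left; apply/eqP.
  by field; rewrite gt_eqF.
have c1_gt0 : 0 < c + 1 by exact: ltr_wpDl.
have q2_ge1 : 1 <= q ^+ 2 by rewrite exprn_ege1.
have M1c : M.+1%:R <= (c + 1) * q ^+ 2 by rewrite -natr1; lra.
have lnM : ln M.+1%:R <= (c + 3) * q.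
  apply: (@le_trans _ _ (ln ((c + 1) * q ^+ 2))).
    by rewrite ler_ln ?posrE// mulr_gt0 ?exprn_gt0.
  rewrite lnM ?posrE ?exprn_gt0// lnXn//.
  have : ln (c + 1) <= c + 1 by rewrite ltW// ln_sublinear.
  have : c * 1 <= c * q by rewrite ler_wpM2l.
  lra.
have lnM0 : 0 <= ln M.+1%:R :> R by rewrite ln_ge0// ler1n.
exists B, M; split => //.
- by rewrite -/a -ler_pdivrMr// ltW.
- move=> k kM; rewrite -/a.
  have kB : k%:R * B <= a.
    by rewrite -ler_pdivlMr//; apply: le_trans MaB; rewrite ler_nat.
  rewrite max_r ?subr_ge0//.
  have amgm : k.+1%:R * (a - k%:R * B) <= a ^+ 2 / (4 * B) + a / 2 + B / 4.
    by rewrite -natr1; exact: le_quadratic_max.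
  (* Here [1 + g = (1 + gamma) * (2 - theta1)] and [theta1 * (2 - theta1) <= 1], which leaves
     [(1 - theta1) * r] for the remaining terms. *)
  have a2 : (1 + g) * (a ^+ 2 / (4 * B)) <= theta1 * r.
    have -> : (1 + g) * (a ^+ 2 / (4 * B)) = theta1 ^+ 2 * (2 - theta1) * r.
      rewrite /a exprMn L2 q4 /A /B /g; field.
      by rewrite !gt_eqF.
    rewrite expr2 -!mulrA ler_pM2l//.
    rewrite mulrA ler_piMl//; first exact: ltW.
    have := sqr_ge0 (1 - theta1); rewrite expr2; lra.
  have q23 : q ^+ 2 <= q ^+ 3 by rewrite ler_weXn2l.
  have rest1 : (1 + g) * (a / 2 + B / 4) <= (1 + g) * (c1 / 2 + 1 / (4 * s)) * q ^+ 3.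
    rewrite -mulrA ler_wpM2l//.
    rewrite mulrDl; apply: lerD; first by lra.
    have -> : B / 4 = y * (1 / (8 * s)) by rewrite /B; field; rewrite gt_eqF.
    have -> : 1 / (4 * s) * q ^+ 3 = (2 * q ^+ 3) * (1 / (8 * s)).
      by field; rewrite gt_eqF.
    rewrite ler_wpM2r//; first by rewrite divr_ge0// mulr_ge0.
    by lra.
  have rest2 : k.+1%:R * (C + ln M.+1%:R) + ln M.+1%:R
      <= (c + 2) * (C + c + 3) * q ^+ 3.
    apply: (@le_trans _ _ (((c + 2) * q ^+ 2) * ((C + c + 3) * q))); last first.
      by rewrite le_eqVlt; apply/orP; left; apply/eqP; ring.
    have Cq : C * 1 <= C * q by rewrite ler_wpM2l.
    apply: (@le_trans _ _ ((k.+1%:R + 1) * (C + ln M.+1%:R))); first by lra.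
    apply: ler_pM; [by rewrite addr_ge0|by rewrite addr_ge0| |by lra].
    have : k.+1%:R <= M.+1%:R :> R by rewrite ler_nat.
    by lra.
  have Dq3 : D * q ^+ 3 <= (1 - theta1) * r.
    have : D <= q * (1 - theta1) by rewrite -ler_pdivrMr.
    have -> : (1 - theta1) * r = q * (1 - theta1) * q ^+ 3 by rewrite -q4; ring.
    by move=> h; rewrite ler_wpM2r ?exprn_ge0.
  have : (1 + g) * (k.+1%:R * (a - k%:R * B)) <=
         (1 + g) * (a ^+ 2 / (4 * B) + a / 2 + B / 4).
    by rewrite ler_wpM2l.
  move: Dq3; rewrite /D; lra.
- have -> : s * B = y / 2 by rewrite /B; field; rewrite gt_eqF.
  rewrite ey.
  have : (theta1 - theta) * (sA * q ^+ 2 * D2) <= (theta1 - theta) * L.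
    by rewrite ler_wpM2l// ltW.
  have -> : (theta1 - theta) * (sA * q ^+ 2 * D2) = (lambda / s + `|c0|) * q ^+ 2.
    rewrite /D2; field.
    by rewrite !gt_eqF.
  have : `|c0| * 1 <= `|c0| * q ^+ 2 by rewrite ler_wpM2l.
  have := ler_norm c0.
  have -> : lambda * q ^+ 2 / s = lambda / s * q ^+ 2 by ring.
  lra.
Qed.

Theorem theorem1 (R : realType) (s lambda K : R)
  (dE : measure_display) (E : measurableType dE) (rho : E -> E -> R)
  (d : measure_display) (Omega : measurableType d) (P : probability Omega R)
  (X : Omega -> R -> E) (gamma : R) :
  0 < s -> 0 < lambda -> 1 <= K ->
  distortion rho ->
  (exists w : R, forall x y, rho x y <= w) ->
  upper_box_dim rho = gamma%:E ->
  (forall w, in_D (X w)) ->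
  (forall t, 0 <= t < 1 -> measurable_fun setT (fun w => X w t)) ->
  (forall k : nat, (P [set w | njumps (X w) = k]
      <= (lambda ^+ k / (k`!)%:R * expR (- lambda) * K)%:E)%E) ->
  (1 <= @limf_einf R R^o R (fun r : R^o => (- lne (Dq P rho X s r))
          * ((Num.sqrt (2 / (s * (1 + gamma)) * r * ln r))^-1)%:E)
        (pinfty_nbhs R^o))%E.
Proof.
move=> s0 lambda0 K1 rhoP [W rhoW] dimE XD mX PN.
have [_ _ rho0 _] := rhoP.
have [w0 _] := probability_inhabited _ _ _ P.
have gamma0 := box_dim_ge0 _ _ rho gamma (X w0 0) dimE.
apply/lee_mul01Pr => // theta /andP[theta0 theta_lt1]; rewrite mule1.
(* Two margins are needed: [1 - theta1] pays for the excess of [g] over [gamma] and the lower-order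
   part of the log-size, [theta1 - theta] for the additive terms in the error exponent. *)
pose theta1 := (1 + theta) / 2.
have tt1 : theta < theta1 by rewrite /theta1; lra.
have theta1_lt1 : theta1 < 1 by rewrite /theta1; lra.
have [|C C0 net] := box_dim_net _ _ rho gamma
  (gamma + (1 + gamma) * (1 - theta1)) dimE.
  by rewrite ltrDl mulr_gt0//; lra.
have [r0 r0P] := rate_choice _ s lambda gamma C (ln (1 + W) + ln K / s) theta1 theta
  s0 lambda0 gamma0 C0 theta0 tt1 theta1_lt1.
rewrite limf_einfE.
apply: (@le_trans _ _ (ereal_inf [set ((- lne (Dq P rho X s r))
   * ((Num.sqrt (2 / (s * (1 + gamma)) * r * ln r))^-1)%:E)%E
   | r in [set r : R | r0 < r]]));
  last first.
  apply: ereal_sup_ubound; exists [set r : R | r0 < r] => //.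
  by exists r0; split => //; exact: num_real.
apply: le_ereal_inf_tmp => _ [r /= rr0 <-].
have [B [M [L0 B0 LM codes rate]]] := r0P r rr0.
rewrite lee_pdivlMr// leeNr.
have := Dq_le_exp _ s lambda K _ E rho _ Omega P X W C _ _ B r M s0 lambda0 K1 rhoP
  rhoW XD mX PN net B0 LM codes.
set D := Dq _ _ _ _ _ => Dle.
have D0 : (0 <= D)%E.
  by apply: le_ereal_inf_tmp => _ [n [c [_ _ ->]]]; exact: poweR_ge0.
apply: le_trans (_ : (lne (expR (- (theta * Num.sqrt
  (2 / (s * (1 + gamma)) * r * ln r))))%:E <= _)%E); last first.
  by rewrite lne_EFin ?expR_gt0// expRK -EFinM -EFinN.
(* [lne] is monotone on all of [[0, +oo]], so a vanishing error needs no separate case. *)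
rewrite lee_lne ?in_itv/= ?leey ?D0 ?lee_fin ?expR_ge0//.
apply: (le_trans Dle); rewrite lee_fin ler_expR; lra.
Qed.
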